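(* Let $p\in(0,1)$ be a constant (independent of $n$). Then for every $d\in\mathbb{N}$ and every $\varepsilon>0$ there exists $n_0$ such that for all $n\ge n_0$, $$u_d(n,p)\le(2+\varepsilon)\left[\frac d2\right]\log_{\frac{1}{1-p}}(np)\quad\text{and}\quad u_d'(n,p)\le(2+\varepsilon)\left[\frac d2\right]\log_{\frac{1}{1-p}}(np).$$
   Context: $G(n,p)$ is the Erdős–Rényi random graph on $n$ labelled vertices (vertex set $V$), each edge present independently with probability $p$; $\mathbb{P}_{n,p}$ is the corresponding probability; $[x]$ is the integer part. A diameter graph in $\mathbb{R}^d$ is a graph $(V,E)$ with $V\subset\mathbb{R}^d$ finite and $E=\{\{\mathbf{x},\mathbf{y}\}\subseteq V: |\mathbf{x}-\mathbf{y}|=\operatorname{diam}V\}$, where $\operatorname{diam}V=\max_{\mathbf{x},\mathbf{y}\in V}|\mathbf{x}-\mathbf{y}|$ (Euclidean norm); a graph is a diameter graph in $\mathbb{R}^d$ if it is isomorphic to one. $u_d(n,p)$ is the largest positive integer $k$ such that $\mathbb{P}_{n,p}\big(\exists W\subseteq V,\ |W|=k,\ G[W]$ is a diameter graph in $\mathbb{R}^d$ and $\chi(G[W])=d+1\big)>\frac12$, where $G[W]$ is the induced subgraph; if no such $k$ exists, $u_d(n,p)=0$. $u_d'(n,p)$ is defined identically with the additional requirement that $G[W]$ be connected.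
   Formalization: The formal theorem assumes d ≥ 2; for d = 0 and d = 1 the stated bound is 0 because [d/2] = 0, while u_0(n,p) ≥ 1 (a single vertex) and u_1(n,p) ≥ 2 (a single edge) for large n, so the claim is false there. *)

(* Defs.v *)
From Stdlib Require Import Reals ClassicalEpsilon.
From HB Require Import structures.
From mathcomp Require Import all_boot.

Set Implicit Arguments.
Unset Strict Implicit.
Unset Printing Implicit Defensive.

Definition upairs (n : nat) : {set 'I_n * 'I_n} := [set x : 'I_n * 'I_n | (x.1 < x.2)%N].

(* adjacency in the graph with edge set E (E is a set of pairs (i,j), i<j) *)
Definition adj (n : nat) (E : {set 'I_n * 'I_n}) (i j : 'I_n) : bool :=
  (i != j) && (((i, j) \in E) || ((j, i) \in E)).

Definition point (d : nat) := 'I_d -> R.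

Definition eucl_dist (d : nat) (x y : point d) : R :=
  sqrt (\big[Rplus/R0]_(i < d) Rsqr (Rminus (x i) (y i))).

Definition diam_of (d n : nat) (f : 'I_n -> point d) (W : {set 'I_n}) : R :=
  \big[Rmax/R0]_(u in W) \big[Rmax/R0]_(v in W) eucl_dist (f u) (f v).

Definition is_diameter_graph (d n : nat) (E : {set 'I_n * 'I_n})
    (W : {set 'I_n}) : Prop :=
  exists f : 'I_n -> point d,
    {in W &, injective f} /\
    forall i j, i \in W -> j \in W ->
      (adj E i j <-> (i <> j /\ eucl_dist (f i) (f j) = diam_of f W)).

Definition colorable (n : nat) (E : {set 'I_n * 'I_n}) (W : {set 'I_n})
    (k : nat) : bool :=
  [exists c : {ffun 'I_n -> 'I_k},
     [forall i, forall j, [&& i \in W, j \in W & adj E i j] ==> (c i != c j)]].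

Lemma colorable_n (n : nat) (E : {set 'I_n * 'I_n}) (W : {set 'I_n}) :
  exists k, colorable E W k.
Proof.
exists n; apply/existsP; exists [ffun i => i].
apply/forallP => i; apply/forallP => j; apply/implyP => /and3P [_ _].
by rewrite !ffunE => /andP [].
Qed.

Definition chromatic_number (n : nat) (E : {set 'I_n * 'I_n})
    (W : {set 'I_n}) : nat :=
  ex_minn (colorable_n E W).

Definition induced_rel (n : nat) (E : {set 'I_n * 'I_n}) (W : {set 'I_n}) :
  rel 'I_n := fun x y => [&& x \in W, y \in W & adj E x y].

Definition connected_on (n : nat) (E : {set 'I_n * 'I_n}) (W : {set 'I_n}) :
  bool := [forall i in W, forall j in W, connect (induced_rel E W) i j].

Definition prob_Gnp (n : nat) (p : R) (A : {set 'I_n * 'I_n} -> Prop) : R :=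
  \big[Rplus/R0]_(E in powerset (upairs n))
     (if excluded_middle_informative (A E)
      then Rmult (pow p #|E|) (pow (Rminus R1 p) (#|upairs n| - #|E|))
      else R0).

Definition Rltb (x y : R) : bool := if Rlt_dec x y then true else false.

Definition event_u (d n k : nat) (conn : bool) (E : {set 'I_n * 'I_n}) : Prop :=
  exists W : {set 'I_n},
    #|W| = k /\ is_diameter_graph d E W /\ chromatic_number E W = d.+1 /\
    (conn = true -> connected_on E W).

(* largest positive k with probability > 1/2, or 0 if none.  Only k <= n
   need be considered: for k > n the event is empty (probability 0). *)
Definition u_gen (conn : bool) (d n : nat) (p : R) : nat :=
  \max_(k < n.+1 | (leq 1 k) && Rltb (Rinv 2) (prob_Gnp p (@event_u d n k conn)))
     (k : nat).

Definition u_d (d n : nat) (p : R) : nat := u_gen false d n p.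
Definition u_d' (d n : nat) (p : R) : nat := u_gen true d n p.

Definition log_base (b x : R) : R := Rdiv (ln x) (ln b).

(* Main.v *)
(** Three distinct points at the same distance from a further point are not
    collinear, and parts that are mutually at a constant distance have mutually
    orthogonal affine hulls.  Hence a diameter graph in R^d does not contain the
    complete multipartite graph with [d/2] + 1 parts of size 3, and by the
    Erdos-Stone theorem a diameter graph on k vertices has at least
    (1 - o(1)) k^2 / (2 [d/2]) non-edges.  On the other hand, a labelled diameter
    graph on k vertices is the zero pattern of k(k-1)/2 quadratic polynomials in
    kd + 1 variables (the coordinates and the diameter), so by linear algebra
    there are only exp(O(k log k)) of them.  The expected number of k-subsets of
    G(n,p) inducing a diameter graph is therefore at most
    n^k exp(O(k log k)) (1-p)^((1 - o(1)) k^2 / (2 [d/2])), which is small as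
    soon as k > (2 + eps) [d/2] log_{1/(1-p)} (np). *)

Require Import Defs.
From Stdlib Require Import Reals.
From HB Require Import structures.
From mathcomp Require Import all_boot.
From Stdlib Require Import Lra ClassicalEpsilon.

Set Implicit Arguments.
Unset Strict Implicit.
Unset Printing Implicit Defensive.

(** * Real estimates *)

Section Estimates.
Local Open Scope R_scope.

Lemma exp_le_mono (x y : R) : x <= y -> exp x <= exp y.
Proof. by case=> [lt|->]; [apply/Rlt_le/exp_increasing|apply: Rle_refl]. Qed.

Lemma ln_le_mono (x y : R) : 0 < x -> x <= y -> ln x <= ln y.
Proof. by move=> x0 [lt|->]; [apply/Rlt_le/ln_increasing|apply: Rle_refl]. Qed.

Lemma ln_le_id (x : R) : 0 < x -> ln x <= x.
Proof.
move=> x0; have := exp_ineq1_le (ln x); rewrite exp_ln //; lra.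
Qed.

(* With [x] the square root of [k], the argument is at most [(2 x)^4]. *)
Lemma ln_two_sqr_le (k : R) : 1 <= k -> ln (2 * k ^ 2 + 1) <= 8 * sqrt k.
Proof.
move=> k1; have x1 : 1 <= sqrt k by rewrite -sqrt_1; apply: sqrt_le_1_alt.
have le4 : 2 * k ^ 2 + 1 <= (2 * sqrt k) ^ 4.
  rewrite -{1}(sqrt_sqrt k); last lra.
  have : 1 <= sqrt k ^ 4 by apply: pow_R1_Rle.
  have -> : (2 * sqrt k) ^ 4 = 16 * sqrt k ^ 4 by ring.
  have -> : (sqrt k * sqrt k) ^ 2 = sqrt k ^ 4 by ring.
  lra.
apply: (Rle_trans _ (ln ((2 * sqrt k) ^ 4))).
  by apply: ln_le_mono => //; have := pow2_ge_0 k; lra.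
rewrite ln_pow; last lra.
have := @ln_le_id (2 * sqrt k); rewrite INR_IZR_INZ /=; lra.
Qed.

(** With [x = sqrt k], each positive term is at most a constant times [x ^ 3], the logarithm costing
    [8 * x], while the negative term is [L * s * x ^ 4]. The hypothesis on [k] makes [L * s * x] at
    least one more than the sum of these constants. *)
Lemma exponent_le (L s D B k c : R) :
  0 < L -> 0 < s -> 0 <= D -> 0 <= B -> 0 <= c -> 1 <= k ->
  ((L + B + c + 8 * (D + 1) + 1) / (L * s)) ^ 2 <= k ->
  - (L * s * k ^ 2) + k * (L + B) + c + (k * D + 1) * ln (2 * k ^ 2 + 1) <= -1.
Proof.
move=> L0 s0 D0 B0 c0 k1 hk.
have Ls : 0 < L * s by apply: Rmult_lt_0_compat.
have hl := ln_two_sqr_le k1.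
have x1 : 1 <= sqrt k by rewrite -sqrt_1; apply: sqrt_le_1_alt.
have hx : L + B + c + 8 * (D + 1) + 1 <= L * s * sqrt k.
  apply: (Rmult_le_reg_l (/ (L * s))); first exact: Rinv_0_lt_compat.
  have -> : / (L * s) * (L * s * sqrt k) = sqrt k by field; lra.
  rewrite Rmult_comm -(sqrt_pow2 (_ * / _)).
    exact: sqrt_le_1_alt.
  by apply: Rmult_le_pos; [lra|apply/Rlt_le/Rinv_0_lt_compat].
have ek : k = sqrt k ^ 2 by rewrite pow2_sqrt //; lra.
move: (sqrt k) x1 hx hl ek => x x1 hx hl ek.
have kD : 0 <= k * D + 1 <= k * (D + 1) by nra.
have h1 : (k * D + 1) * ln (2 * k ^ 2 + 1) <= k * (D + 1) * (8 * x).
  apply: (Rle_trans _ ((k * D + 1) * (8 * x))); first by apply: Rmult_le_compat_l; lra.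
  by apply: Rmult_le_compat_r; lra.
rewrite ek in h1 kD *.
have x2 : 1 <= x ^ 2 by nra.
have x3 : x ^ 2 <= x ^ 3 by nra.
have h2 : x ^ 2 * (L + B) <= x ^ 3 * (L + B) by apply: Rmult_le_compat_r; lra.
have h3 : c <= x ^ 3 * c by nra.
have h4 : x ^ 3 * (L + B + c + 8 * (D + 1) + 1) <= x ^ 3 * (L * s * x).
  by apply: Rmult_le_compat_l; lra.
have -> : L * s * (x ^ 2) ^ 2 = x ^ 3 * (L * s * x) by ring.
lra.
Qed.

Lemma exp_m1_le : exp (-1) <= / 2.
Proof.
have -> : -1 = - (1) by lra.
rewrite exp_Ropp; apply: Rinv_le_contravar; first lra.
by have := exp_ineq1_le 1; lra.
Qed.

(* The hypothesis [hK] says [k > (2 + eps) r log_{1/(1-p)} (n p)], where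
   [L = - ln (1 - p)]. *)
Lemma first_moment_le (p L D c a s k n : R) :
  0 < p -> p < 1 -> 0 < L -> 0 < a -> 0 < s -> 0 <= D -> 0 <= c -> 1 <= k -> 0 < n ->
  ((L + (- ln p) + c + 8 * (D + 1) + 1) / (L * s)) ^ 2 <= k ->
  a * (ln (n * p) / L) <= k ->
  exp (k * ln n) * exp ((k * D + 1) * ln (2 * k ^ 2 + 1)) *
  exp (- (L * ((s + / a) * k ^ 2 - k) - c)) <= / 2.
Proof.
move=> p0 p1 L0 a0 s0 D0 c0 k1 n0 hk hK.
rewrite -!exp_plus; apply: Rle_trans exp_m1_le.
have lnp : 0 <= - ln p by have := ln_le_mono p0 (Rlt_le _ _ p1); rewrite ln_1; lra.
have h := exponent_le L0 s0 D0 lnp c0 k1 hk.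
apply: exp_le_mono.
(* Up to a term linear in [k], [k * ln n] is absorbed by the [/ a] share of the quadratic exponent;
   the surplus [s] remains. *)
have ln_n : ln n <= / a * (L * k) - ln p.
  suff : ln n + ln p <= / a * (L * k) by lra.
  rewrite -ln_mult //; apply: (Rmult_le_reg_l (a / L)); first exact: Rdiv_lt_0_compat.
  have -> : a / L * (/ a * (L * k)) = k by field; lra.
  by apply: Rle_trans hK; apply: Req_le; field; lra.
have h2 : k * ln n <= k * (/ a * (L * k) - ln p) by apply: Rmult_le_compat_l; lra.
apply: Rle_trans h; nra.
Qed.

Lemma pow_exp_ln (x : R) (m : nat) : 0 < x -> x ^ m = exp (INR m * ln x).
Proof. by move=> x0; rewrite -Rpower_pow. Qed.

Lemma nonedges_ge (r Q C k m : R) : 0 < r -> 0 <= Q -> 0 <= k ->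
  Q * (k * (k + 1)) <= r * (Q + 1) * (2 * k + 2 * m + C) ->
  Q / (Q + 1) / (2 * r) * k ^ 2 - k - C / 2 <= m.
Proof.
move=> r0 Q0 k0 h.
have rQ : 0 < 2 * (r * (Q + 1)) by apply: Rmult_lt_0_compat; [lra|apply: Rmult_lt_0_compat; lra].
apply: (Rmult_le_reg_l (2 * (r * (Q + 1)))) => //.
have -> : 2 * (r * (Q + 1)) * (Q / (Q + 1) / (2 * r) * k ^ 2 - k - C / 2) =
    Q * k ^ 2 - r * (Q + 1) * (2 * k + C) by field; lra.
have : 0 <= Q * k by apply: Rmult_le_pos.
lra.
Qed.

(** As [Q] grows, the first term tends to [/ (2 * r)], which exceeds the second. The gap is the
    surplus [s] in the exponent. *)
Lemma ex_density_gap (r eps : R) : 0 < r -> 0 < eps ->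
  exists Q : nat, 0 < INR Q / (INR Q + 1) / (2 * r) - / ((2 + eps) * r).
Proof.
move=> r0 e0; have [Q hQ] := INR_unbounded (2 / eps); exists Q.
have Q0 : 0 < INR Q by apply: Rlt_trans hQ; apply: Rdiv_lt_0_compat; lra.
have {}hQ : 2 < INR Q * eps.
  apply: (Rmult_lt_reg_r (/ eps)); first exact: Rinv_0_lt_compat.
  by have -> : INR Q * eps * / eps = INR Q by field; lra.
have -> : INR Q / (INR Q + 1) / (2 * r) - / ((2 + eps) * r) =
    (INR Q * eps - 2) / (2 * r * (INR Q + 1) * (2 + eps)) by field; lra.
apply: Rdiv_lt_0_compat; first lra.
by repeat apply: Rmult_lt_0_compat; lra.
Qed.

Lemma ex_ln_mul_ge (p M : R) : 0 < p ->
  exists n0 : nat, forall n : nat, INR n0 <= INR n -> 0 < INR n /\ M <= ln (INR n * p).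
Proof.
move=> p0; have [n0 h0] := INR_unbounded (exp M / p); exists n0 => n hn.
have e0 := exp_pos M.
have n0' : 0 < INR n.
  by apply: Rlt_le_trans hn; apply: Rlt_trans h0; apply: Rdiv_lt_0_compat.
split=> //; rewrite -[X in X <= _](ln_exp M); apply: ln_le_mono => //.
apply: (Rmult_le_reg_r (/ p)); first exact: Rinv_0_lt_compat.
have -> : INR n * p * / p = INR n by field; lra.
rewrite /Rdiv in h0; lra.
Qed.

End Estimates.

From mathcomp Require Import all_order all_algebra.
From mathcomp Require Import Rstruct zify ring lra.
From mathcomp Require Import mpoly.

(** * Zero patterns of polynomials *)

Section ZeroPatterns.
Import GRing.Theory.
Local Open Scope ring_scope.

Lemma msize_prod_le (N : nat) (F : idomainType) (T : finType) (A : {set T})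
    (f : T -> {mpoly F[N]}) (D : nat) :
  (forall a, a \in A -> (msize (f a) <= D.+1)%N) ->
  (msize (\prod_(a in A) f a) <= (#|A| * D).+1)%N.
Proof.
move=> hf; rewrite -sum_nat_const -big_enum -[X in (_ <= X.+1)%N]big_enum /=.
have: forall a, a \in enum A -> (msize (f a) <= D.+1)%N.
  by move=> a; rewrite mem_enum; apply: hf.
elim: (enum A) => [|a s IH] hs; first by rewrite !big_nil msize1.
rewrite !big_cons.
have ha := hs a (mem_head _ _).
have hs' : (msize (\prod_(j <- s) f j) <= (\sum_(j <- s) D).+1)%N.
  by apply: IH => b hb; apply: hs; rewrite in_cons hb orbT.
have [->|nz_a] := eqVneq (f a) 0; first by rewrite mul0r msize0.
have [->|nz_s] := eqVneq (\prod_(j <- s) f j) 0; first by rewrite mulr0 msize0.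
by rewrite msizeM // -subn1 leq_subLR add1n -addSn -addnS leq_add.
Qed.

Lemma card_bmultinom_le (N D : nat) : (#|{: 'X_{1..N < D.+1}}| <= D.+1 ^ N)%N.
Proof.
rewrite -[X in (_ <= X ^ _)%N]card_ord -[X in (_ <= _ ^ X)%N]card_ord -card_ffun.
pose g (m : 'X_{1..N < D.+1}) : {ffun 'I_N -> 'I_D.+1} := [ffun i => inord (m i)].
apply: (@leq_card _ _ g) => m1 m2 /ffunP h.
apply/eqP; rewrite bmeqP; apply/eqP/mnmP => i.
have lt (m : 'X_{1..N < D.+1}) : (m i < D.+1)%N.
  by apply: leq_ltn_trans (bmdeg m); rewrite mdegE (bigD1 i) //= leq_addr.
by have := h i; rewrite !ffunE => /(congr1 (@nat_of_ord _)); rewrite !inordK.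
Qed.

(* The products of the nonvanishing polynomials of the patterns, evaluated at
   the witnesses, form a matrix that is triangular for inclusion; its rank is
   bounded by the number of monomials. *)
Lemma card_zero_patterns (N : nat) (F : fieldType) (T : finType) (B : {set T})
    (f : T -> {mpoly F[N]}) (D : nat) (Zs : {set {set T}}) :
  (forall a, a \in B -> (msize (f a) <= D.+1)%N) ->
  (forall Z, Z \in Zs -> Z \subset B /\
     exists v : 'I_N -> F, forall a, a \in B -> (a \in Z) = ((f a).@[v] == 0)) ->
  (#|Zs| <= (#|B| * D).+1 ^ N)%N.
Proof.
move=> hf hZ.
pose M := (#|B| * D)%N; pose ev := @enum_val _ (mem Zs).
have evP z : ev z \in Zs by apply: enum_valP.
apply: leq_trans (card_bmultinom_le N M).
have /fin_all_exists [v hv] : forall z : 'I_#|Zs|, exists v : 'I_N -> F,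
    forall a, a \in B -> (a \in ev z) = ((f a).@[v] == 0).
  by move=> z; have [_] := hZ _ (evP z).
pose g (z : 'I_#|Zs|) := \prod_(a in B :\: ev z) f a.
have szg z : (msize (g z) <= M.+1)%N.
  apply: leq_trans (_ : _ <= (#|B :\: ev z| * D).+1)%N _.
    by apply: msize_prod_le => a /setDP [aB _]; apply: hf.
  by rewrite ltnS leq_mul2r subset_leq_card ?orbT // subsetDl.
(* Triangularity: [g z] vanishes at [v z'] exactly when a polynomial outside the pattern [ev z]
   does. *)
have gE z z' : ((g z).@[v z'] != 0) = (ev z' \subset ev z).
  rewrite /g rmorph_prod /= prodf_seq_neq0 /=; apply/allP/subsetP => h a.
    move=> az'; apply: contraLR (az') => naz.
    have aB : a \in B by apply: (subsetP (hZ _ (evP z')).1).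
    rewrite (hv _ _ aB); apply: implyP (h a _) _; first exact: mem_index_enum.
    by rewrite in_setD naz.
  move=> _; apply/implyP => /setDP [aB naz]; rewrite -hv //.
  by apply: contra naz; apply: h.
pose K := #|{: 'X_{1..N < M.+1}}|.
pose em : 'I_K -> 'X_{1..N < M.+1} := @enum_val _ _.
(* Evaluation factors as coefficients times values of the [K] monomials of degree at most [M], so
   its rank is at most [K]. *)
pose C : 'M[F]_(#|Zs|, K) := \matrix_(z, m) (g z)@_(em m).
pose E : 'M[F]_(K, #|Zs|) := \matrix_(m, z) ('X_[em m] : {mpoly F[N]}).@[v z].
have CE z z' : (C *m E) z z' = (g z).@[v z'].
  rewrite mxE [in RHS](mpolywE (szg z)) raddf_sum /=.
  rewrite (reindex em) /=; last first.
    by apply: onW_bij; apply: enum_val_bij.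
  by apply: eq_bigr => m _; rewrite !mxE mevalZ.
suff /eqP <- : row_free (C *m E) by rewrite (leq_trans (mulmx_max_rank _ _)).
apply: inj_row_free => u hu; apply/rowP => z; rewrite mxE.
apply/eqP; apply: contraT => nz.
(* Take [y] in the support of [u] with a largest pattern. In column [y], a row of the support
   contributes only if its pattern contains [ev y], which leaves row [y] alone. *)
case: (@arg_maxnP _ z [pred w : 'I_#|Zs| | u 0 w != 0] (fun w => #|ev w|) nz) => y ny ymax.
move/rowP/(_ y): hu; rewrite !mxE (bigD1 y) //= big1 ?addr0 => [|w nwy].
  move/eqP; rewrite mulf_eq0 (negPf ny) CE /=.
  by apply: contraLR; rewrite gE.
have [->|nw] := eqVneq (u 0 w) 0; first by rewrite mul0r.
rewrite CE; apply/eqP; rewrite mulf_eq0 (negPf nw) /=; apply: contraT.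
rewrite gE => sub; case/eqP: nwy; apply: enum_val_inj; apply/esym/eqP.
by rewrite eqEcard sub; apply: ymax.
Qed.

End ZeroPatterns.

(** * Mutually equidistant parts *)

Section UnitDistance.
Import Order.TTheory GRing.Theory Num.Theory.
Local Open Scope ring_scope.
Variables (F : realFieldType) (d : nat).
Implicit Types (u v w x y : 'rV[F]_d).

Definition dot u v : F := \sum_i u 0 i * v 0 i.

Lemma dotC u v : dot u v = dot v u.
Proof. by apply: eq_bigr => i _; rewrite mulrC. Qed.

Lemma dotBr u v w : dot u (v - w) = dot u v - dot u w.
Proof. by rewrite /dot -sumrB; apply: eq_bigr => i _; rewrite !mxE mulrBr. Qed.

Lemma dotBl u v w : dot (u - v) w = dot u w - dot v w.
Proof. by rewrite dotC dotBr !(dotC w). Qed.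

Lemma dotZr a u v : dot u (a *: v) = a * dot u v.
Proof. by rewrite /dot mulr_sumr; apply: eq_bigr => i _; rewrite !mxE mulrCA. Qed.

Lemma dotZl a u v : dot (a *: u) v = a * dot u v.
Proof. by rewrite dotC dotZr dotC. Qed.

Lemma dot_eq0 u : (dot u u == 0) = (u == 0).
Proof.
apply/eqP/eqP => [h|->]; last by rewrite /dot big1 // => i _; rewrite !mxE mul0r.
apply/rowP => i; rewrite mxE; apply/eqP; rewrite -sqrf_eq0 expr2; apply/eqP.
by move/psumr_eq0P: h; apply=> // j _; rewrite -expr2 sqr_ge0.
Qed.

(** The Gram matrix is diagonal with nonzero diagonal, so the vectors are independent. *)
Lemma card_orthogonal_le (I : finType) (b : I -> 'rV[F]_d) :
  (forall i, dot (b i) (b i) != 0) ->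
  (forall i j, i != j -> dot (b i) (b j) = 0) -> (#|I| <= d)%N.
Proof.
move=> nz orth.
pose ev : 'I_#|I| -> I := @enum_val _ _.
pose B : 'M[F]_(#|I|, d) := \matrix_(i, k) b (ev i) 0 k.
suff /eqP <- : row_free B by apply: rank_leq_col.
apply: inj_row_free => u hu; apply/rowP => i; rewrite mxE.
have /rowP/(_ i)/eqP : u *m (B *m B^T) = 0 by rewrite mulmxA hu mul0mx.
rewrite !mxE (bigD1 i) //= big1 => [|j nij].
  rewrite addr0 mulf_eq0 => /orP [/eqP //|].
  rewrite mxE; under eq_bigr => k _ do rewrite !mxE.
  by rewrite [_ == _](negPf (nz _)).
rewrite [X in _ * X]mxE; under [X in _ * X]eq_bigr => k _ do rewrite !mxE.
rewrite [X in _ * X](orth (ev j) (ev i)) ?mulr0 //.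
by apply: contra_neq nij; apply: enum_val_inj.
Qed.

(* The affine hulls of the parts are mutually orthogonal, and three points
   equidistant from a point of another part are not collinear. *)
Lemma equidistant_parts_le (q : nat) (x : 'I_q -> 'I_3 -> 'rV[F]_d) (t : F) :
  (1 < q)%N -> (forall i, injective (x i)) ->
  (forall i j a b, i != j -> dot (x i a - x j b) (x i a - x j b) = t) ->
  (q.*2 <= d)%N.
Proof.
move=> q1 inj eqd.
pose o (k : nat) : 'I_3 := inord k.
have [A AE] : {A : 'I_q -> 'rV[F]_d | forall i, A i = x i (o 1%N) - x i (o 0%N)} by eexists.
have [C CE] : {C : 'I_q -> 'rV[F]_d | forall i, C i = x i (o 2%N) - x i (o 0%N)} by eexists.
(* Two directions per part: [A i] and the Gram-Schmidt remainder of [C i], scaled by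
   [dot (A i) (A i)] to avoid division. *)
pose b (ie : 'I_q * bool) :=
  if ie.2 then dot (A ie.1) (A ie.1) *: C ie.1 - dot (A ie.1) (C ie.1) *: A ie.1
  else A ie.1.
have no k l : (k < 3)%N -> (l < 3)%N -> k <> l -> o k <> o l.
  by move=> hk hl nkl /(congr1 (@nat_of_ord _)); rewrite !inordK.
(* The alternating sum of the four squared distances, all equal to [t], is twice this product up to
   sign. *)
have par i j a a' c c' : i != j -> dot (x i a - x i a') (x j c - x j c') = 0.
  move=> ij.
  have := eqd i j a c ij; have := eqd i j a c' ij.
  have := eqd i j a' c ij; have := eqd i j a' c' ij.
  rewrite !(dotBl, dotBr) ![dot (x j _) (x i _)]dotC; lra.
have sub_nz i k l : (k < 3)%N -> (l < 3)%N -> k <> l ->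
    dot (x i (o k) - x i (o l)) (x i (o k) - x i (o l)) != 0.
  move=> hk hl nkl; rewrite dot_eq0 subr_eq0; apply/eqP => /inj.
  exact: no.
suff : (#|{: 'I_q * bool}| <= d)%N by rewrite card_prod card_ord card_bool muln2.
apply: (@card_orthogonal_le _ b) => [[i [|]]|[i e] [j e'] nij]; rewrite /b /=.
(* A zero remainder makes [C i] parallel to [A i]. Equidistance from a point of another part, which
   exists since [1 < q], then forces [A i = C i], so two of the three points coincide. *)
- rewrite dot_eq0; apply/eqP => h.
  have [j nij] : exists j : 'I_q, i != j.
    have [->|] := eqVneq i (Ordinal (ltnW q1)); last by exists (Ordinal (ltnW q1)).
    by exists (Ordinal q1).
  pose w := x i (o 0%N) - x j (o 0%N).
  have e0 := eqd i j (o 0%N) (o 0%N) nij.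
  have e1 := eqd i j (o 1%N) (o 0%N) nij.
  have e2 := eqd i j (o 2%N) (o 0%N) nij.
  have hw : dot (A i) (A i) * dot (C i) w = dot (A i) (C i) * dot (A i) w.
    apply/eqP; rewrite -subr_eq0 -!dotZl -dotBl h.
    by rewrite /dot big1 // => k _; rewrite mxE mul0r.
  have hc : dot (A i) (A i) * dot (C i) (C i) = dot (A i) (C i) * dot (A i) (C i).
    apply/eqP; rewrite -subr_eq0 -!dotZl -dotBl h.
    by rewrite /dot big1 // => k _; rewrite mxE mul0r.
  have a1 : dot (A i) (A i) = - 2 * dot (A i) w.
    move: e0 e1; rewrite AE /w !(dotBl, dotBr) ?(dotC (x j _)) ?(dotC (x i (o 0%N))); lra.
  have a2 : dot (C i) (C i) = - 2 * dot (C i) w.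
    move: e0 e2; rewrite CE /w !(dotBl, dotBr) ?(dotC (x j _)) ?(dotC (x i (o 0%N))); lra.
  have nzA : dot (A i) (A i) != 0 by rewrite AE; apply: sub_nz.
  have nzC : dot (C i) (C i) != 0 by rewrite CE; apply: sub_nz.
  have ac : dot (C i) (C i) = dot (A i) (C i).
    apply: (mulfI nzA); rewrite {1}a2 mulrCA hw mulrCA -a1 mulrC //.
  have aa : dot (A i) (A i) = dot (A i) (C i).
    by apply: (mulIf nzC); rewrite hc ac.
  have : dot (A i - C i) (A i - C i) = 0.
    by rewrite !(dotBl, dotBr) (dotC (C i) (A i)) ac aa; ring.
  apply/eqP; suff -> : A i - C i = x i (o 1%N) - x i (o 2%N) by apply: sub_nz.
  by rewrite AE CE opprB addrA subrK.
- by rewrite AE; apply: sub_nz.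
- have [eij|neij] := eqVneq i j; last first.
    have p1 : dot (A i) (A j) = 0 by rewrite ?AE ?CE; apply: par.
    have p2 : dot (A i) (C j) = 0 by rewrite ?AE ?CE; apply: par.
    have p3 : dot (C i) (A j) = 0 by rewrite ?AE ?CE; apply: par.
    have p4 : dot (C i) (C j) = 0 by rewrite ?AE ?CE; apply: par.
    by case: e {nij}; case: e'; rewrite ?(dotBl, dotBr, dotZl, dotZr) ?p1 ?p2 ?p3 ?p4; ring.
  rewrite -{}eij in nij *.
  by case: e nij; case: e'; rewrite ?eqxx // => _;
    rewrite ?(dotBl, dotBr, dotZl, dotZr) ?(dotC (C i) (A i)); ring.
Qed.

End UnitDistance.

(** * The Erdos-Stone theorem *)

Section CompleteMultipartite.

(** Parts are indexed by [nat] so that one can be appended without casts. Their disjointness follows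
    when [e] is irreflexive. *)
Definition complete_parts (T : finType) (e : rel T) (V : {set T}) (q s : nat) :=
  exists A : nat -> {set T},
    (forall i, i < q -> A i \subset V /\ #|A i| = s) /\
    (forall i j x y, i < q -> j < q -> i <> j -> x \in A i -> y \in A j -> e x y).

(** For irreflexive [e], a vertex of [V] belongs to its own set. *)
Definition nonnbrs (T : finType) (e : rel T) (V : {set T}) (v : T) : {set T} :=
  [set u in V | ~~ e v u].

Definition take_set (T : finType) (s : nat) (A : {set T}) : {set T} :=
  [set x in take s (enum A)].

Lemma take_set_sub (T : finType) (s : nat) (A : {set T}) : take_set s A \subset A.
Proof. by apply/subsetP => x; rewrite inE => /mem_take; rewrite mem_enum. Qed.

Lemma card_take_set (T : finType) (s : nat) (A : {set T}) :
  s <= #|A| -> #|take_set s A| = s.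
Proof.
move=> h; rewrite cardsE; have /card_uniqP -> := take_uniq s (enum_uniq (mem A)).
by rewrite size_takel // -cardE.
Qed.

Lemma complete_parts_sub (T : finType) (e : rel T) (V V' : {set T}) (q s : nat) :
  V' \subset V -> complete_parts e V' q s -> complete_parts e V q s.
Proof.
move=> sV [A [hA hE]]; exists A; split=> // i /hA [sA ->]; split=> //.
exact: subset_trans sA sV.
Qed.

Lemma large_fiber (T U : finType) (G : {set T}) (P : {set U}) (f : T -> U) (s : nat) :
  (forall x, x \in G -> f x \in P) -> s * #|P| < #|G| ->
  exists u, s < #|[set x in G | f x == u]|.
Proof.
move=> hf lt; case: (boolP [exists u, s < #|[set x in G | f x == u]|]).
  by move=> /existsP.
rewrite negb_exists => /forallP h; move: lt; rewrite ltnNge -sum1_card.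
rewrite (partition_big f (mem P)) //= mulnC -sum_nat_const leq_sum // => u _.
by rewrite sum1_card leqNgt -cardsE; apply: h.
Qed.

(* Double counting: a vertex with few neighbours in some part [A i] has many
   non-neighbours there, so most of these would violate the degree bound. *)
Lemma complete_parts_step (T : finType) (e : rel T) (V : {set T}) (r Q s j : nat) :
  ssrbool.symmetric e -> 0 < r -> 0 < s -> j <= r ->
  (forall v, v \in V -> r * Q.+1 * #|nonnbrs e V v| <= Q * #|V|) ->
  complete_parts e V j (2 * Q.+1 * s) ->
  (2 * Q).+1 * (s * 2 ^ (j * (2 * Q.+1 * s))) < #|V| ->
  complete_parts e V j.+1 s.
Proof.
set t := 2 * Q.+1 * s => sym r0 s0 jr deg [A [hA hE]] ltV.
pose N v := [set u | e v u].
pose Gd := [set v in V | [forall i : 'I_j, s <= #|A i :&: N v|]].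
have badsum : #|V :\: Gd| * (t - s) <= \sum_(i < j) \sum_(u in A i) #|nonnbrs e V u|.
  have cnt (i : 'I_j) : \sum_(u in A i) #|nonnbrs e V u| =
      \sum_(v in V) #|A i :\: N v|.
    under eq_bigr => u _ do rewrite -sum1_card big_mkcond /=.
    under [in RHS]eq_bigr => u _ do rewrite -sum1_card big_mkcond /=.
    rewrite [RHS]exchange_big /= [RHS](bigID (mem (A i))) /=.
    rewrite [X in _ + X]big1 ?addn0 => [|u uA]; last first.
      by rewrite big1 // => v _; rewrite in_setD (negPf uA) andbF.
    apply: eq_bigr => u uA; rewrite [RHS]big_mkcond /=.
    by apply: eq_bigr => v _; rewrite !inE uA andbT sym; case: (v \in V).
  under eq_bigr => i _ do rewrite cnt.
  rewrite exchange_big /= -sum_nat_const [leqRHS](big_setID (V :\: Gd)) /=.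
  rewrite (setIidPr (subsetDl _ _)); apply: leq_trans (leq_addr _ _).
  apply: leq_sum => v /setDP [vV]; rewrite inE vV /= negb_forall => /existsP [i].
  rewrite -ltnNge => hi; rewrite (bigD1 i) //=; apply: leq_trans (leq_addr _ _).
  by rewrite cardsD (hA _ (ltn_ord i)).2 leq_sub2l // ltnW.
have sumle : r * Q.+1 * (\sum_(i < j) \sum_(u in A i) #|nonnbrs e V u|)
    <= j * (t * (Q * #|V|)).
  rewrite big_distrr /= -[X in _ <= X * _]card_ord -sum_nat_const leq_sum // => i _.
  have [sAV cA] := hA _ (ltn_ord i).
  rewrite big_distrr /= -[X in _ <= X * _]cA -sum_nat_const leq_sum // => u uA.
  by apply: deg; apply: (subsetP sAV).
(* As [t - s = (2 * Q).+1 * s], the factors [r], [Q.+1] and [s] cancel; at least a [1 / (2Q + 1)]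
   share of [V] is good. *)
have bad_le : #|V :\: Gd| * (2 * Q).+1 <= 2 * Q * #|V|.
  have h1 : r * Q.+1 * (#|V :\: Gd| * (t - s)) <= r * (t * (Q * #|V|)).
    apply: leq_trans (leq_trans _ sumle) _; first by rewrite leq_mul2l badsum orbT.
    by rewrite leq_mul2r jr orbT.
  have ets : t - s = (2 * Q).+1 * s by rewrite /t; lia.
  rewrite -(leq_pmul2l (_ : 0 < r * Q.+1 * s)); last by rewrite !muln_gt0 r0.
  move: h1; rewrite ets /t; congr (_ <= _); ring.
have good_ge : #|V| <= (2 * Q).+1 * #|Gd|.
  have sG : Gd \subset V by apply/subsetP => v; rewrite inE => /andP [].
  have := cardsID Gd V; rewrite (setIidPr sG) => eV.
  nia.
pose U := \bigcup_(i < j) A i.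
have cU : #|U| <= j * t.
  rewrite -[X in _ <= X * _]card_ord -sum_nat_const.
  apply: (@leq_trans (\sum_(i < j) #|A i|)); last first.
    by apply: leq_sum => i _; rewrite (hA _ (ltn_ord i)).2.
  rewrite /U; elim/big_rec2: _ => [|i m X _ IH]; first by rewrite cards0.
  by apply: leq_trans (leq_card_setU _ _) _; rewrite leq_add2l.
(* Pigeonhole over at most [2 ^ (j * t)] traces on [U]: more than [s] good vertices share a trace
   [X]. They supply the new part, and each old part is cut down inside [X]. *)
have [||X ltX] := @large_fiber _ _ Gd (powerset U) (fun v => N v :&: U) s.
- by move=> v _; rewrite powersetE subsetIr.
- rewrite -(ltn_pmul2l (_ : 0 < (2 * Q).+1)) //; apply: leq_trans good_ge.
  apply: leq_ltn_trans ltV; rewrite leq_mul2l leq_mul2l card_powerset.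
  by rewrite leq_exp2l // cU !orbT.
pose Z := [set v in Gd | N v :&: U == X].
exists (fun i => if i == j then take_set s Z else take_set s (A i :&: X)).
have [v vZ] : exists v, v \in Z by apply/card_gt0P; apply: leq_ltn_trans ltX.
have ZV : Z \subset V by apply/subsetP => w; rewrite !inE => /andP [/andP []].
split=> [i|i k x y].
  rewrite ltnS leq_eqVlt; case: eqP => [_ _|_ /= ij].
    by rewrite card_take_set ?(ltnW ltX) // (subset_trans (take_set_sub _ _)).
  split.
    apply: subset_trans (take_set_sub _ _) _.
    by apply: subset_trans (subsetIl _ _) _; apply: (hA _ ij).1.
  rewrite card_take_set //; move: vZ; rewrite inE => /andP [vG /eqP <-].
  move: vG; rewrite inE => /andP [_ /forallP /(_ (Ordinal ij)) /= h].
  apply: leq_trans h _; apply/subset_leq_card/subsetP => x; rewrite !in_setI.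
  move=> /andP [xA ->]; rewrite xA /=.
  by apply/bigcupP; exists (Ordinal ij).
have ZX w u k' : w \in take_set s Z -> u \in take_set s (A k' :&: X) -> e w u.
  move=> /(subsetP (take_set_sub _ _)); rewrite inE => /andP [_ /eqP <-].
  by move=> /(subsetP (take_set_sub _ _)); rewrite !inE => /and3P [].
rewrite !ltnS => ij kj nik.
case: eqP => [ei|/eqP nij]; case: eqP => [ek|/eqP nkj]; first by rewrite ei ek in nik.
- exact: ZX.
- by rewrite sym => xA yZ; apply: ZX yZ xA.
- move=> /(subsetP (take_set_sub _ _)) /setIP [xA _].
  move=> /(subsetP (take_set_sub _ _)) /setIP [yA _].
  by apply: hE nik xA yA; rewrite ltn_neqAle ?nij ?nkj.
Qed.

(** Induction on [j]: each stage asks the previous one for parts [2 * Q.+1] times larger, since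
    adding a part shrinks the others. *)
Lemma min_degree_complete_parts (r Q j s : nat) : 0 < r -> 0 < s -> j <= r.+1 ->
  exists n0, forall (T : finType) (e : rel T) (V : {set T}), ssrbool.symmetric e ->
    n0 < #|V| ->
    (forall v, v \in V -> r * Q.+1 * #|nonnbrs e V v| <= Q * #|V|) ->
    complete_parts e V j s.
Proof.
move=> r0; elim: j s => [|j IH] s s0 jr.
  by exists 0 => T e V _ _ _; exists (fun _ => set0); split.
have [||n0 hn0] := IH (2 * Q.+1 * s); [by rewrite !muln_gt0 s0|exact: ltnW|].
exists (maxn n0 ((2 * Q).+1 * (s * 2 ^ (j * (2 * Q.+1 * s))))) => T e V sym.
rewrite gtn_max => /andP [lt1 lt2] deg.
by apply: (complete_parts_step sym r0 s0 jr deg _ lt2); apply: hn0.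
Qed.

(** Deleting [v] removes the ordered pairs with [v] in either place; doubling counts [(v, v)] twice,
    hence the successor. *)
Lemma nonnbrs_sum_setD1 (T : finType) (e : rel T) (V : {set T}) (v : T) :
  ssrbool.symmetric e -> irreflexive e -> v \in V ->
  (\sum_(u in V) #|nonnbrs e V u|).+1 =
  \sum_(u in V :\ v) #|nonnbrs e (V :\ v) u| + 2 * #|nonnbrs e V v|.
Proof.
move=> sym irr vV.
have card_split u : #|nonnbrs e V u| = ~~ e u v + #|nonnbrs e (V :\ v) u|.
  rewrite (cardsD1 v) inE vV /=; congr (_ + _); apply: eq_card => x.
  by rewrite !inE andbA.
rewrite (big_setD1 v vV) /= (eq_bigr _ (fun u _ => card_split u)) big_split /=.
have -> : \sum_(u in V :\ v) ~~ e u v = #|nonnbrs e V v|.-1.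
  rewrite (cardsD1 v) inE vV irr /= -sum1_card big_mkcond [RHS]big_mkcond /=.
  by apply: eq_bigr => u _; rewrite !inE sym; case: (u == v); case: (u \in V); case: (e v u).
have : 0 < #|nonnbrs e V v| by apply/card_gt0P; exists v; rewrite inE vV irr.
case: #|_| => // m _; rewrite /=; lia.
Qed.

(* Erdos-Stone, by peeling off vertices of low degree; the sum counts ordered
   pairs and includes the diagonal. *)
Lemma complete_parts_free_nonnbrs (r Q s : nat) : 0 < r -> 0 < s ->
  exists C, forall (T : finType) (e : rel T) (V : {set T}),
    ssrbool.symmetric e -> irreflexive e -> ~ complete_parts e V r.+1 s ->
    Q * (#|V| * #|V|.+1) <=
    r * Q.+1 * (\sum_(u in V) #|nonnbrs e V u| + #|V| + C).
Proof.
move=> r0 s0; have [n0 hn0] := min_degree_complete_parts Q r0 s0 (leqnn r.+1).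
(* This constant settles the sets with at most [n0] vertices, where the peeling stops. *)
exists (n0 * n0.+1) => T e V sym irr.
elim: {V}#|V| {-2}V (erefl #|V|) => [|n IH] V cV free; first by rewrite cV muln0.
have [le_n|gt_n] := leqP #|V| n0.
  have h : #|V| * #|V|.+1 <= n0 * n0.+1 by apply: leq_mul.
  nia.
have [v vV hv] : exists2 v, v \in V & Q * #|V| < r * Q.+1 * #|nonnbrs e V v|.
  apply/exists_inP; apply: contra_notT free; rewrite negb_exists_in => /forall_inP h.
  by apply: hn0 => // v vV; rewrite leqNgt h.
have cV' : #|V :\ v| = n by move: cV; rewrite (cardsD1 v) vV => -[].
have free' : ~ complete_parts e (V :\ v) r.+1 s.
  by move=> h; apply: free; apply: complete_parts_sub h; apply: subsetDl.
(* Removing [v] lowers [#|V| * #|V|.+1] by [2 * #|V|], and the sum plus [#|V|] by exactly twice the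
   non-neighbours of [v], so [hv] closes the induction. *)
have := IH _ cV' free'; have := nonnbrs_sum_setD1 sym irr vV; rewrite cV' cV in hv *.
set S := \sum_(u in V) _; set S' := \sum_(u in V :\ v) _; nia.
Qed.

End CompleteMultipartite.

(** * Diameter graphs *)

Section DiameterGraphs.
Import Order.TTheory GRing.Theory Num.Theory.
Local Open Scope ring_scope.

Lemma adj_sym (n : nat) (E : {set 'I_n * 'I_n}) : ssrbool.symmetric (adj E).
Proof. by move=> i j; rewrite /adj eq_sym orbC. Qed.

Lemma adj_irr (n : nat) (E : {set 'I_n * 'I_n}) : irreflexive (adj E).
Proof. by move=> i; rewrite /adj eqxx. Qed.

Lemma eucl_dist_eqP (d : nat) (x y : point d) (D : R) : 0 <= D ->
  eucl_dist x y = D <-> \sum_(i < d) (x i - y i) ^+ 2 = D ^+ 2.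
Proof.
move=> D0; rewrite /eucl_dist RsqrtE.
have -> : \big[Rplus/R0]_(i < d) Rsqr (Rminus (x i) (y i)) =
    \sum_(i < d) (x i - y i) ^+ 2 by [].
have S0 : 0 <= \sum_(i < d) (x i - y i) ^+ 2 by apply: sumr_ge0 => i _; apply: sqr_ge0.
split=> [<-|->]; first by rewrite sqr_sqrtr.
by rewrite sqrtr_sqr ger0_norm.
Qed.

Lemma diam_of_ge0 (d n : nat) (f : 'I_n -> point d) (W : {set 'I_n}) : 0 <= diam_of f W.
Proof.
rewrite /diam_of.
have max0 (I : finType) (P : pred I) (g : I -> R) : 0 <= \big[Rmax/R0]_(i | P i) g i.
  by elim/big_rec: _ => [|i x _ x0]; rewrite ?lexx // RmaxE le_max x0 orbT.
exact: max0.
Qed.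

(** Turns adjacency into a polynomial equation in the coordinates and [t], as both the geometry and
    the counting require. *)
Lemma is_diameter_graphP (d n : nat) (E : {set 'I_n * 'I_n}) (W : {set 'I_n}) :
  is_diameter_graph d E W ->
  exists (f : 'I_n -> 'I_d -> R) (t : R),
    {in W &, injective f} /\
    forall i j, i \in W -> j \in W -> i != j ->
      adj E i j = (\sum_(a < d) (f i a - f j a) ^+ 2 == t ^+ 2).
Proof.
move=> [f [inj h]]; exists f, (diam_of f W); split=> // i j iW jW nij.
have D := eucl_dist_eqP (f i) (f j) (diam_of_ge0 f W).
apply/idP/eqP => [/(h i j iW jW) [_ /D]//|/D e].
by apply/(h i j iW jW); split=> //; apply/eqP.
Qed.

(** Such parts would give [2 * (d./2).+1 <= d]; [2 <= d] ensures at least two parts. *)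
Lemma diameter_graph_parts_free (d n : nat) (E : {set 'I_n * 'I_n}) (W : {set 'I_n}) :
  (2 <= d)%N -> is_diameter_graph d E W -> ~ complete_parts (adj E) W (d./2).+1 3.
Proof.
move=> d2 /is_diameter_graphP [f [t [inj hadj]]] [A [hA hE]].
have [g hg] : exists g : 'I_(d./2).+1 -> 'I_3 -> 'I_n,
    forall i, injective (g i) /\ forall a, g i a \in A i.
  have /fin_all_exists [g hg] : forall i : 'I_(d./2).+1, exists g : 'I_3 -> 'I_n,
      injective g /\ forall a, g a \in A i.
    move=> i; have [_ cA] := hA _ (ltn_ord i).
    exists (fun a => enum_val (cast_ord (esym cA) a)); split=> [a b|a].
      by move=> /enum_val_inj /cast_ord_inj.
    exact: enum_valP.
  by exists g.
have gW i a : g i a \in W by apply: (subsetP (hA _ (ltn_ord i)).1); apply: (hg i).2.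
pose x i a : 'rV[R]_d := \row_k f (g i a) k.
have := @equidistant_parts_le R d _ x (t ^+ 2).
suff h : (forall i, injective (x i)) /\ (forall i j a b, i != j ->
    dot (x i a - x j b) (x i a - x j b) = t ^+ 2).
  have d2' : (1 < (d./2).+1)%N by rewrite ltnS half_gt0.
  by move=> /(_ d2' h.1 h.2); rewrite -[X in (_ <= X)%N]odd_double_half; case: (odd d); lia.
split=> [i a b /rowP e|i j a b nij].
  apply: (hg i).1; apply: inj => //; apply: boolp.funext => k.
  by have := e k; rewrite !mxE.
have e : adj E (g i a) (g j b).
  apply: (hE _ _ _ _ (ltn_ord i) (ltn_ord j) _ ((hg i).2 a) ((hg j).2 b)).
  by move=> /val_inj eij; rewrite eij eqxx in nij.
have ne : g i a != g j b by case/andP: e.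
rewrite hadj // in e; rewrite -(eqP e) /dot; apply: eq_bigr => k _.
by rewrite !mxE expr2.
Qed.

(** * Counting labelled diameter graphs and their non-edges *)

Definition upairs_in (n : nat) (W : {set 'I_n}) : {set 'I_n * 'I_n} :=
  [set x in upairs n | (x.1 \in W) && (x.2 \in W)].

Lemma card_upairs_in_le (n : nat) (W : {set 'I_n}) : (#|upairs_in W| <= #|W| ^ 2)%N.
Proof.
rewrite -mulnn -cardsX; apply/subset_leq_card/subsetP => x.
by case: x => i j; rewrite in_setX inE => /andP [].
Qed.

(** These are the labelled diameter graphs on [W], as edge sets; [asbool] makes the predicate
    boolean so that they form a finite set. *)
Definition diameter_traces (d n : nat) (W : {set 'I_n}) : {set {set 'I_n * 'I_n}} :=
  [set S | boolp.asbool (exists E : {set 'I_n * 'I_n},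
     [/\ E \subset upairs n, is_diameter_graph d E W & S = upairs_in W :&: E])].

Lemma adj_upairs (n : nat) (E : {set 'I_n * 'I_n}) (i j : 'I_n) :
  E \subset upairs n -> (i < j)%N -> adj E i j = ((i, j) \in E).
Proof.
move=> /subsetP sE ij; rewrite /adj.
have -> : i != j by apply: contraTneq ij => ->; rewrite ltnn.
have /negPf -> : (j, i) \notin E; last by rewrite orbF.
by apply: contraL ij => /sE; rewrite inE /= -leqNgt => /ltnW.
Qed.

Lemma card_diameter_traces_le (d n : nat) (W : {set 'I_n}) :
  (#|diameter_traces d W| <= (2 * #|W| ^ 2).+1 ^ (#|W| * d).+1)%N.
Proof.
(* The variables: [None] is the diameter, [Some] a coordinate of a vertex of [W]. Outside [W], [pv]
   defaults to 0. *)
pose V := option {ia : 'I_n * 'I_d | ia.1 \in W}.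
pose pv (i : 'I_n) (a : 'I_d) : {mpoly R[#|{: V}|]} :=
  if insub (i, a) is Some u then 'X_(enum_rank (Some u : V)) else 0.
pose pt : {mpoly R[#|{: V}|]} := 'X_(enum_rank (None : V)).
pose f (ij : 'I_n * 'I_n) := \sum_a (pv ij.1 a - pv ij.2 a) ^+ 2 - pt ^+ 2.
have cV : #|{: V}| = (#|W| * d).+1.
  rewrite card_option card_sig; congr _.+1.
  rewrite -[X in (_ * X)%N]card_ord -cardsT -cardsX; apply: eq_card => [[i a]].
  by rewrite in_setX !inE andbT.
rewrite -cV; apply: (@leq_trans ((#|upairs_in W| * 2).+1 ^ #|{: V}|)).
  apply: (@card_zero_patterns _ R _ (upairs_in W) f) => [[i j] _|S].
    apply: leq_trans (msizeD_le _ _) _; rewrite geq_max mmeasureN.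
    have sq (p : {mpoly R[#|{: V}|]}) : (msize p <= 2 -> msize (p ^+ 2) <= 3)%N.
      have [->|nz h] := eqVneq p 0; first by rewrite expr0n msize0.
      by rewrite expr2 msizeM // -subn1 leq_subLR (leq_add h h).
    have X2 k : (msize ('X_k : {mpoly R[#|{: V}|]}) <= 2)%N by rewrite msizeX mdeg1.
    have pv2 k a : (msize (pv k a) <= 2)%N.
      by rewrite /pv; case: insub => [u|]; rewrite ?X2 ?msize0.
    rewrite (sq _ (X2 _)) andbT; apply: leq_trans (msize_sum _ _ _) _.
    apply/bigmax_leqP => a _; apply: sq.
    by apply: leq_trans (msizeD_le _ _) _; rewrite geq_max mmeasureN !pv2.
  rewrite inE => /boolp.asboolP [E [sE /is_diameter_graphP [g [t [inj h]]] ->]].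
  split; first exact: subsetIl.
  exists (fun k => if enum_val k is Some u then g (val u).1 (val u).2 else t).
  case=> i j hij; rewrite inE hij /=; move: hij.
  rewrite !inE /= => /and3P [ij iW jW].
  rewrite -adj_upairs // h //; last by apply: contraTneq ij => ->; rewrite ltnn.
  rewrite /f rmorphB rmorph_sum /= rmorphXn /= mevalXU enum_rankK subr_eq0.
  congr (_ == _); apply: eq_bigr => a _; rewrite rmorphXn rmorphB /= /pv.
  by rewrite !insubT /= !mevalXU !enum_rankK.
by rewrite leq_exp2r ?cV // ltnS mulnC leq_mul2l card_upairs_in_le.
Qed.

(** An ordered non-adjacent pair is diagonal, a missing pair, or the reversal of one. *)
Lemma sum_nonnbrs_le (n : nat) (E : {set 'I_n * 'I_n}) (W : {set 'I_n}) :
  (\sum_(u in W) #|nonnbrs (adj E) W u| <= #|W| + 2 * #|upairs_in W :\: E|)%N.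
Proof.
pose M := upairs_in W :\: E.
pose P := [set x : 'I_n * 'I_n | [&& x.1 \in W, x.2 \in W & ~~ adj E x.1 x.2]].
have -> : (\sum_(u in W) #|nonnbrs (adj E) W u|)%N = #|P|.
  under eq_bigr => u _ do rewrite -sum1_card.
  rewrite pair_big_dep -sum1_card; apply: eq_bigl => x /=.
  by rewrite !inE.
have sP : P \subset [set (u, u) | u in W] :|: (M :|: [set (x.2, x.1) | x in M]).
  apply/subsetP => [[u v]]; rewrite !inE /= => /and3P [uW vW].
  rewrite /adj; have [->|nuv /=] := eqVneq u v; first by rewrite imset_f.
  rewrite negb_or => /andP [h1 h2]; move: nuv; rewrite neq_ltn => /orP [lt|lt].
    by rewrite h1 uW vW lt orbT.
  apply/orP; right; apply/orP; right; apply/imsetP; exists (v, u) => //.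
  by rewrite !inE h2 /= uW vW lt.
apply: leq_trans (subset_leq_card sP) _.
apply: leq_trans (leq_card_setU _ _) _; apply: leq_add; first exact: leq_imset_card.
apply: leq_trans (leq_card_setU _ _) _; rewrite mul2n -addnn leq_add2l.
exact: leq_imset_card.
Qed.

Lemma diameter_traces_nonedges (d Q : nat) : (2 <= d)%N ->
  exists C, forall (n : nat) (W : {set 'I_n}) (S : {set 'I_n * 'I_n}),
    S \in diameter_traces d W ->
    (Q * (#|W| * #|W|.+1) <=
     d./2 * Q.+1 * (2 * #|W| + 2 * #|upairs_in W :\: S| + C))%N.
Proof.
move=> d2; have r0 : (0 < d./2)%N by rewrite half_gt0.
have [C hC] := complete_parts_free_nonnbrs Q r0 (isT : 0 < 3)%N.
exists C => n W S; rewrite inE => /boolp.asboolP [E [sE hE ->]].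
apply: leq_trans (hC _ _ W (@adj_sym _ E) (@adj_irr _ E) _) _.
  exact: diameter_graph_parts_free.
rewrite leq_mul2l; apply/orP; right; rewrite leq_add2r.
have := sum_nonnbrs_le E W.
have -> : upairs_in W :\: (upairs_in W :&: E) = upairs_in W :\: E.
  by rewrite setDIr setDv set0U.
set a := (\sum_(u in W) _)%N; lia.
Qed.

End DiameterGraphs.

(** * The first moment *)

Section Probability.
Import Order.TTheory GRing.Theory Num.Theory.
Local Open Scope ring_scope.

Lemma sum_powerset_weight (F : comNzRingType) (T : finType) (V : {set T}) (p : F) :
  \sum_(E in powerset V) p ^+ #|E| * (1 - p) ^+ (#|V| - #|E|) = 1.
Proof.
(* With [H] zero and [G] one outside [V], expanding the product over the whole type leaves only
   subsets of [V]. *)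
pose G x := if x \in V then 1 - p else 1.
pose H x := if x \in V then p else 0.
have : \prod_x (H x + G x) = 1.
  by apply: big1 => x _; rewrite /H /G; case: (x \in V); ring.
rewrite bigA_distr => e; rewrite -[RHS]e [RHS](bigID (mem (powerset V))) /=.
rewrite [X in _ = _ + X]big1 ?addr0 => [|J].
  apply: eq_bigr => J; rewrite powersetE => sJ.
  rewrite (bigID (mem J)) /=; congr (_ * _).
    rewrite -prodr_const. apply: eq_bigr => x xJ.
    by rewrite xJ /H (subsetP sJ).
  rewrite -[in LHS](cardsID J V) (setIidPr sJ) addKn -prodr_const.
  rewrite big_mkcond [RHS]big_mkcond /=; apply: eq_bigr => x _.
  by rewrite inE /G; case: (x \in J).
rewrite powersetE => /subsetPn [x xJ nxV].
by rewrite (bigD1 x) //= xJ /H (negPf nxV) mul0r.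
Qed.

(** The probability that all of [M] is absent: the weights on [U :\: M] sum to one. *)
Lemma sum_weight_disjoint (F : comNzRingType) (T : finType) (U M : {set T}) (p : F) :
  M \subset U ->
  \sum_(E in powerset U | [disjoint E & M]) p ^+ #|E| * (1 - p) ^+ (#|U| - #|E|) =
  (1 - p) ^+ #|M|.
Proof.
move=> sM; rewrite -[RHS]mulr1 -[X in _ = _ * X](sum_powerset_weight (U :\: M) p) mulr_sumr.
have eP E : (E \in powerset U) && [disjoint E & M] = (E \in powerset (U :\: M)).
  by rewrite !powersetE subsetD.
rewrite (eq_bigl _ _ eP); apply: eq_bigr => E; rewrite powersetE => sE.
rewrite mulrCA -exprD; congr (_ * _ ^+ _).
by rewrite addnBA ?subset_leq_card // -[in LHS](cardsID M U) (setIidPr sM).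
Qed.

(** Union bound over [k]-sets [W] and traces [S], where having trace [S] is relaxed to missing every
    pair of [upairs_in W :\: S]. *)
Lemma prob_diameter_le (d n k : nat) (conn : bool) (p b : R) :
  0 < p -> p < 1 -> 0 <= b ->
  (forall (W : {set 'I_n}) S, #|W| = k -> S \in diameter_traces d W ->
     (1 - p) ^+ #|upairs_in W :\: S| <= b) ->
  prob_Gnp p (@event_u d n k conn) <=
  'C(n, k)%:R * ((2 * k ^ 2).+1 ^ (k * d).+1)%:R * b.
Proof.
move=> p0 p1 b0 hb.
have q0 : 0 <= 1 - p by rewrite subr_ge0 ltW.
pose w (E : {set 'I_n * 'I_n}) := p ^+ #|E| * (1 - p) ^+ (#|upairs n| - #|E|).
have w0 E : 0 <= w E by rewrite mulr_ge0 // exprn_ge0 // ltW.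
pose hit (W : {set 'I_n}) (S E : {set 'I_n * 'I_n}) := [disjoint E & upairs_in W :\: S].
apply: (@le_trans _ _ (\sum_(W in [set W : {set 'I_n} | #|W| == k])
    \sum_(S in diameter_traces d W)
    \sum_(E in powerset (upairs n) | hit W S E) w E)).
  apply: (@le_trans _ _ (\sum_(E in powerset (upairs n))
      \sum_(W in [set W : {set 'I_n} | #|W| == k])
      \sum_(S in diameter_traces d W) if hit W S E then w E else 0)); last first.
    rewrite exchange_big /=; apply: ler_sum => W _.
    rewrite exchange_big /=; apply: ler_sum => S _.
    by rewrite big_mkcondr.
  apply: ler_sum => E; rewrite powersetE => sE.
  have term0 W S : 0 <= if hit W S E then w E else 0 by case: ifP.
  case: (excluded_middle_informative _) => [[W [cW [hW ?]]]|?] /=; last first.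
    by apply: sumr_ge0 => W _; apply: sumr_ge0.
  rewrite !RpowE RmultE -/(w E) (bigD1 W) ?inE ?cW //=.
  have hS : upairs_in W :&: E \in diameter_traces d W.
    by rewrite inE; apply/boolp.asboolP; exists E.
  rewrite (bigD1 _ hS) /= ifT.
    rewrite -addrA lerDl addr_ge0 //; first exact: sumr_ge0.
    by apply: sumr_ge0 => ? _; apply: sumr_ge0.
  rewrite /hit -setI_eq0; apply/eqP/setP => x; rewrite !inE.
  by case: (x \in E); rewrite ?andbF //= andbT andNb.
apply: (@le_trans _ _ (\sum_(W in [set W : {set 'I_n} | #|W| == k])
    ((2 * k ^ 2).+1 ^ (k * d).+1)%:R * b)); last first.
  rewrite sumr_const -[X in X <= _]mulr_natl mulrA; apply: ler_wpM2r => //.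
  by rewrite card_draws card_ord.
apply: ler_sum => W; rewrite inE => /eqP cW.
apply: (@le_trans _ _ (\sum_(S in diameter_traces d W) b)).
  apply: ler_sum => S SW; rewrite /hit sum_weight_disjoint; first exact: hb.
  by apply: subset_trans (subsetDl _ _) _; apply/subsetP => x; rewrite inE => /andP [].
rewrite sumr_const -[X in X <= _]mulr_natl; apply: ler_wpM2r => //.
by rewrite ler_nat -cW card_diameter_traces_le.
Qed.

End Probability.

(** * From the first moment to the logarithmic bound *)

Section UpperBound.
Local Open Scope R_scope.

Lemma bin_le_expn (n k : nat) : ('C(n, k) <= n ^ k)%N.
Proof.
apply: (@leq_trans (n ^_ k)); first by rewrite -bin_ffact leq_pmulr ?fact_gt0.
rewrite ffact_prod -[X in (_ <= _ ^ X)%N]card_ord -prod_nat_const.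
by apply: leq_prod => i _; apply: leq_subr.
Qed.

Lemma INR_expn (n k : nat) : INR (n ^ k)%N = INR n ^ k.
Proof. by rewrite !INRE RpowE GRing.natrX. Qed.

Lemma u_gen_le (conn : bool) (d n : nat) (p K : R) : 0 <= K ->
  (forall k, (0 < k)%N -> K < INR k -> prob_Gnp p (@event_u d n k conn) <= / 2) ->
  INR (u_gen conn d n p) <= K.
Proof.
move=> K0 h; rewrite /u_gen.
elim/big_ind: _ => [|x y hx hy|k /andP [k0]]; first exact: K0.
  by rewrite /maxn; case: ifP.
rewrite /Defs.Rltb; case: Rlt_dec => // lt _.
by apply: Rnot_lt_le => ltK; move: (h k k0 ltK); Lra.lra.
Qed.

(** Nonnegativity of the bound is included because [u_gen] may be 0. *)
Lemma ex_prob_diameter_le (p : R) (d : nat) (eps : R) :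
  0 < p -> p < 1 -> (2 <= d)%N -> 0 < eps ->
  exists n0 : nat, forall n : nat, (n0 <= n)%N ->
    0 <= (2 + eps) * INR d./2 * (ln (INR n * p) / - ln (1 - p)) /\
    forall (conn : bool) (k : nat), (0 < k)%N ->
      (2 + eps) * INR d./2 * (ln (INR n * p) / - ln (1 - p)) <= INR k ->
      prob_Gnp p (@event_u d n k conn) <= / 2.
Proof.
move=> p0 p1 d2 e0; set r := INR d./2; set L := - ln (1 - p).
have r0 : 0 < r by apply/lt_0_INR/ltP; rewrite half_gt0.
have q0 : 0 < 1 - p by Lra.lra.
have L0 : 0 < L.
  by have := ln_increasing (1 - p) 1 q0; rewrite ln_1 /L => h; Lra.lra.
have [Q] := ex_density_gap r0 e0.
set a := (2 + eps) * r; set s := _ - / a => s0.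
have a0 : 0 < a by apply: Rmult_lt_0_compat; Lra.lra.
have [C hC] := diameter_traces_nonedges Q d2.
set c := L * (INR C / 2).
have C0 : 0 <= INR C by apply: pos_INR.
have c0 : 0 <= c by apply: Rmult_le_pos; Lra.lra.
pose y := (L + (- ln p) + c + 8 * (INR d + 1) + 1) / (L * s).
pose k0 := y ^ 2 + 1.
(* For [n >= n0] the logarithmic bound is at least [k0], so every [k] above it meets the size
   condition of [first_moment_le]. *)
have [n0 hn0] := @ex_ln_mul_ge p (k0 * L / a) p0.
have k00 : 1 <= k0 by rewrite /k0; have := pow2_ge_0 y; Lra.lra.
have aL0 : 0 < a / L by apply: Rdiv_lt_0_compat.
exists n0 => n /leP /le_INR /hn0 [n_gt0 hn]; split.
  rewrite -/r -/L -/a; apply: Rmult_le_pos; first exact: Rlt_le.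
  apply: Rmult_le_pos; last exact/Rlt_le/Rinv_0_lt_compat.
  apply: Rle_trans hn; apply: Rmult_le_pos; last exact/Rlt_le/Rinv_0_lt_compat.
  by apply: Rmult_le_pos; Lra.lra.
move=> conn k kpos hk.
have k0k : k0 <= INR k.
  apply: Rle_trans hk; rewrite -/L.
  have -> : k0 = a * (k0 * L / a / L) by field_simplify_eq; [|Lra.lra].
  by apply: Rmult_le_compat_l; [Lra.lra|apply: Rmult_le_compat_r => //; exact/Rlt_le/Rinv_0_lt_compat].
have fm : exp (INR k * ln (INR n)) * exp ((INR k * INR d + 1) * ln (2 * INR k ^ 2 + 1)) *
  exp (- (L * ((s + / a) * INR k ^ 2 - INR k) - c)) <= / 2.
  apply: (@first_moment_le p) => //; first exact: pos_INR.
  - by apply: Rle_trans k0k.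
  - by apply: Rle_trans k0k; rewrite /k0 /y; Lra.lra.
apply: Rle_trans fm.
set b := exp (- (L * _ - c)).
have b0 : 0 < b by apply: exp_pos.
have bound : Rle (prob_Gnp p (@event_u d n k conn))
    (INR 'C(n, k) * INR ((2 * k ^ 2).+1 ^ (k * d).+1) * b).
  rewrite !INRE; apply/RleP; apply: prob_diameter_le; try exact/RltP.
    exact/RleP/Rlt_le.
  move=> W S cW SW; apply/RleP; rewrite -RpowE.
  change (pow (1 - p) #|upairs_in W :\: S| <= b).
  rewrite pow_exp_ln //; apply: exp_le_mono.
  have /leP/le_INR := hC _ _ _ SW; rewrite cW.
  rewrite !(mult_INR, plus_INR, S_INR) -/r => h.
  have := @nonedges_ge r (INR Q) (INR C) (INR k) (INR #|upairs_in W :\: S|) r0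
    (pos_INR _) (pos_INR _).
  have -> : INR Q / (INR Q + 1) / (2 * r) = s + / a by rewrite /s; Lra.lra.
  move=> /(_ ltac:(move: h; rewrite /=; Lra.lra)).
  have -> : ln (1 - p) = - L by rewrite /L; Lra.lra.
  rewrite /c; set m := INR #|_| => hm.
  have : L * ((s + / a) * INR k ^ 2 - INR k - INR C / 2) <= L * m.
    by apply: Rmult_le_compat_l => //; apply: Rlt_le.
  Lra.lra.
apply: Rle_trans bound _; apply: Rmult_le_compat_r; first exact: Rlt_le.
apply: Rmult_le_compat; try exact: pos_INR.
  rewrite -pow_exp_ln // -INR_expn; apply/le_INR/leP.
  exact: bin_le_expn.
rewrite INR_expn pow_exp_ln; last by rewrite S_INR; have := pos_INR (2 * k ^ 2); Lra.lra.
rewrite !(S_INR, mult_INR, INR_expn) /= Rplus_0_l.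
exact: Rle_refl.
Qed.
End UpperBound.

Theorem theorem27 (p : R) (hp0 : Rlt R0 p) (hp1 : Rlt p R1) :
  forall d : nat, leq 2 d ->
  forall eps : R, Rlt R0 eps ->
  exists n0 : nat, forall n : nat, leq n0 n ->
    Rle (INR (u_d d n p))
        (Rmult (Rmult (Rplus 2 eps) (INR d./2))
               (log_base (Rinv (Rminus R1 p)) (Rmult (INR n) p))) /\
    Rle (INR (u_d' d n p))
        (Rmult (Rmult (Rplus 2 eps) (INR d./2))
               (log_base (Rinv (Rminus R1 p)) (Rmult (INR n) p))).
Proof.
move=> d d2 eps eps0.
have [n0 h] := ex_prob_diameter_le hp0 hp1 d2 eps0.
exists n0 => n /h [K0 {}h].
have q0 : Rlt R0 (Rminus R1 p) by apply: Rlt_Rminus.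
(* [ln (/ (1 - p))] becomes [- ln (1 - p)], the form used in the estimates. *)
rewrite /log_base ln_Rinv //.
by split; apply: u_gen_le => // k k0 /Rlt_le; apply: h.
Qed.
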